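(* Let $G_n(a,b)$ be a (random) function of two components, where the first component belongs to an abstract set, and the second belongs to a Euclidean space. Suppose that the (random) points $(a_n,b_n)$ satisfy the inequalities $G_n(a_n,b_n)\le G_n(a_n,0)$ together with the stochastic bound $\|b_n\|=o_p^*(1)$. Let $\beta$ be positive and let $\{\alpha_1,\dots,\alpha_p,\beta_1,\dots,\beta_p\}$ be a collection of nonnegative numbers satisfying $\beta_i<\beta$ for all $i\in\{1,\dots,p\}$. Assume that $G_n$ satisfies a representation $$G_n(a,b)-G_n(a,0)=M_n(a,b)-N_n(a,b),$$ such that $$M_n(a_n,b_n)\gtrsim\|b_n\|^\beta\quad\text{with inner probability tending to one, and}$$ $$[N_n(a_n,b_n)]^+=O_p^*\Big(\sum_{i\le p}n^{-\alpha_i}\|b_n\|^{\beta_i}\Big).$$ Then $\|b_n\|=O_p^*(n^{-\tau_b})$ for $\tau_b=\min_{i\le p}\left\{\frac{\alpha_i}{\beta-\beta_i}\right\}$. If $[N_n]^+\equiv0$, then $\mathbb{P}_*\{b_n=0\}\to1$.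
   Context: Random quantities may be nonmeasurable; $\mathbb{P}^*$ and $\mathbb{P}_*$ denote outer and inner probability. $[x]^+=\max(x,0)$. For nonnegative random $R_n$, $Y_n=O_p^*(R_n)$ means that for every $\varepsilon>0$ there is $L<\infty$ with $\limsup_n\mathbb{P}^*\{|Y_n|>LR_n\}\le\varepsilon$; $Y_n=o_p^*(1)$ means $\mathbb{P}^*\{|Y_n|>\varepsilon\}\to0$ for every $\varepsilon>0$. ''$M_n(a_n,b_n)\gtrsim\|b_n\|^\beta$ with inner probability tending to one'' means that there is a (nonrandom) constant $c_0>0$ such that $\mathbb{P}_*\{M_n(a_n,b_n)\ge c_0\|b_n\|^\beta\}\to1$. The convention $x^0=1$ for all $x\ge0$ is used. No structure is assumed on the set containing the first component $a$. *)

(* Defs.v *)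
From HB Require Import structures.
From mathcomp Require Import all_boot all_order all_algebra.
From mathcomp Require Import all_classical all_reals all_analysis.
Set Implicit Arguments.
Unset Strict Implicit.
Unset Printing Implicit Defensive.
Import Order.TTheory GRing.Theory Num.Theory.
Import numFieldNormedType.Exports.
Local Open Scope classical_set_scope.
Local Open Scope ring_scope.

(* The norm `|b| that the library puts on 'rV[R]_k is the sup norm. *)
Definition enorm (R : realType) (k : nat) (b : 'rV[R]_k) : R :=
  Num.sqrt (\sum_(i < k) b ord0 i ^+ 2).

(* In the next four definitions the events, and the random variables as
   functions of w, are not required to be measurable. *)
Definition outer_prob (R : realType) (d : measure_display)
    (T : measurableType d) (P : probability T R) (E : set T) : \bar R :=
  ereal_inf [set P B | B in [set B | measurable B /\ E `<=` B]].

Definition inner_prob (R : realType) (d : measure_display)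
    (T : measurableType d) (P : probability T R) (E : set T) : \bar R :=
  ereal_sup [set P B | B in [set B | measurable B /\ B `<=` E]].

Definition op1_star (R : realType) (d : measure_display)
    (T : measurableType d) (P : probability T R) (Y : nat -> T -> R) : Prop :=
  forall eps : R, 0 < eps ->
    outer_prob P [set w | eps < `|Y n w|] @[n --> \oo] --> 0%E.

Definition Op_star (R : realType) (d : measure_display)
    (T : measurableType d) (P : probability T R) (Y Rn : nat -> T -> R) : Prop :=
  forall eps : R, 0 < eps -> exists L : R,
    (limn_esup (fun n => outer_prob P [set w | (L * Rn n w < `|Y n w|)%R])
       <= eps%:E)%E.

(* The minimum of a nonempty finite family, with no extra bound: the starting
   value of the iterated minimum is itself a member of the family. *)
Definition min_family (R : realType) (p : nat) (f : 'I_p.+1 -> R) : R :=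
  \big[Num.min/f ord0]_(i < p.+1) f i.

(* [outer_prob] agrees with the library's Caratheodory extension, which uses
   countable measurable covers instead of measurable supersets. *)
Lemma outer_probE (R : realType) (d : measure_display)
    (T : measurableType d) (P : probability T R) (E : set T) :
  outer_prob P E = mu_ext P E.
Proof.
apply/eqP; rewrite eq_le; apply/andP; split.
- apply: le_ereal_inf_tmp => _ [A [mA EA] <-].
  apply: (@le_trans _ _ (P (\bigcup_k A k))).
    apply: ereal_inf_lbound; exists (\bigcup_k A k) => //; split => //.
    exact: bigcup_measurable.
  apply: measure_sigma_subadditive => //; exact: bigcup_measurable.
- apply: le_ereal_inf_tmp => _ [B [mB EB] <-].
  rewrite -(measurable_mu_extE P mB).
  exact: le_mu_ext.
Qed.

(* Main.v *)
(* The minimality of [b n] forces [M <= N^+] at [(a n, b n)]. So outside an event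
   of small outer probability [c0 r^beta <= L sum_i n^(-alpha_i) r^(beta_i)],
   where [r = |b n|]. This fails as soon as [r > K n^(-tau)], where
   [D = L (p + 1) / c0] and [K = sum_i D^(1 / (beta - beta_i))]: for every [i],
   [r > D^(1 / (beta - beta_i)) n^(-alpha_i / (beta - beta_i))], that is
   [r^beta > D n^(-alpha_i) r^(beta_i)], and one sums over the [p + 1] indices.
   When [N^+ = 0] the same inequality reads [c0 r^beta <= 0]. *)
Require Import Defs.
From HB Require Import structures.
From mathcomp Require Import all_boot all_order all_algebra.
From mathcomp Require Import all_classical all_reals all_analysis.
Set Implicit Arguments.
Unset Strict Implicit.
Unset Printing Implicit Defensive.
Import Order.TTheory GRing.Theory Num.Theory.
Import numFieldNormedType.Exports.
Local Open Scope classical_set_scope.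
Local Open Scope ring_scope.

Lemma le_outer_prob (R : realType) (d : measure_display) (T : measurableType d)
    (P : probability T R) (E F : set T) :
  E `<=` F -> (outer_prob P E <= outer_prob P F)%E.
Proof. by move=> EF; rewrite !outer_probE; exact: le_mu_ext. Qed.

Lemma outer_probU2 (R : realType) (d : measure_display) (T : measurableType d)
    (P : probability T R) (E F : set T) :
  (outer_prob P (E `|` F) <= outer_prob P E + outer_prob P F)%E.
Proof. by rewrite !outer_probE; exact: outer_measureU2. Qed.

Lemma le_inner_prob (R : realType) (d : measure_display) (T : measurableType d)
    (P : probability T R) (E F : set T) :
  E `<=` F -> (inner_prob P E <= inner_prob P F)%E.
Proof.
move=> EF; apply: ereal_sup_le => _ [B [mB BE] <-].
by exists B => //; split => //; exact: subset_trans EF.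
Qed.

Lemma inner_prob_le1 (R : realType) (d : measure_display)
    (T : measurableType d) (P : probability T R) (E : set T) :
  (inner_prob P E <= 1)%E.
Proof. by apply: ge_ereal_sup => _ [B [mB _] <-]; exact: probability_le1. Qed.

Lemma outer_prob_setC_lt (R : realType) (d : measure_display)
    (T : measurableType d) (P : probability T R) (E : set T) (e : R) :
  (1 - e%:E < inner_prob P E)%E -> (outer_prob P (~` E) < e%:E)%E.
Proof.
move=> /ereal_sup_gt[_ [B [mB BE] <-] eB].
apply: (@le_lt_trans _ _ (P (~` B))).
  apply: ereal_inf_lbound; exists (~` B) => //; split.
    exact: measurableC.
  exact: subsetC.
rewrite probability_setC//.
move: eB; rewrite -[P B]fineK ?fin_num_measure//.
by rewrite -!EFinB !lte_fin !ltrBlDr addrC.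
Qed.

(** A bound on the limsup controls the terms themselves only up to a slack [e]. *)
Lemma limn_esup_le_near (R : realType) (u : nat -> \bar R) (x e : R) :
  (limn_esup u <= x%:E)%E -> 0 < e ->
  \forall n \near \oo, (u n <= (x + e)%:E)%E.
Proof.
move=> ux e0.
have /ereal_inf_lt[_ [V Voo <-] Ve] : (limn_esup u < (x + e)%:E)%E.
  by apply: le_lt_trans ux _; rewrite lte_fin ltrDl.
near=> n; apply: le_trans (ltW Ve).
by apply: ereal_sup_ubound; exists n => //; near: n.
Unshelve. all: by end_near. Qed.

Lemma near_le_limn_esup (R : realType) (u : nat -> \bar R) (y : \bar R) :
  (\forall n \near \oo, (u n <= y)%E) -> (limn_esup u <= y)%E.
Proof.
move=> uy; apply: (@le_trans _ _ (ereal_sup (u @` [set n | (u n <= y)%E]))).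
  by apply: ereal_inf_lbound; exists [set n | (u n <= y)%E].
by apply: ge_ereal_sup => _ [n /= un <-].
Qed.

Lemma min_family_le (R : realType) (p : nat) (f : 'I_p.+1 -> R) (i : 'I_p.+1) :
  min_family f <= f i.
Proof. by rewrite /min_family; exact: bigmin_le. Qed.

Lemma enorm_ge0 (R : realType) (k : nat) (x : 'rV[R]_k) : 0 <= enorm x.
Proof. exact: sqrtr_ge0. Qed.

Lemma enorm_eq0 (R : realType) (k : nat) (x : 'rV[R]_k) :
  enorm x = 0 -> x = 0.
Proof.
move=> /eqP; rewrite sqrtr_eq0 => s0.
apply/rowP => i; rewrite mxE; apply/eqP; rewrite -sqrf_eq0.
have s00 : \sum_(j < k) x ord0 j ^+ 2 == 0.
  by rewrite eq_le s0 sumr_ge0// => j _; exact: sqr_ge0.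
move: s00; rewrite psumr_eq0; last by move=> j _; exact: sqr_ge0.
by move=> /allP/(_ i); rewrite mem_index_enum => /(_ isT).
Qed.

Lemma powR_rate_lt (R : realType) (x D r al be beta : R) :
  0 < x -> 0 < D -> be < beta ->
  D `^ (beta - be)^-1 * x `^ (- (al / (beta - be))) < r ->
  D * (x `^ (- al) * r `^ be) < r `^ beta.
Proof.
move=> x0 D0 bb; set g := beta - be => rlt.
have g0 : 0 < g by rewrite subr_gt0.
have r0 : 0 < r by apply: le_lt_trans rlt; rewrite mulr_ge0 ?powR_ge0.
have : D * x `^ (- al) < r `^ g.
  have -> : D * x `^ (- al) = (D `^ g^-1 * x `^ (- (al / g))) `^ g.
    rewrite powRM ?powR_ge0// -!powRrM mulVf ?gt_eqF// powRr1 ?ltW//.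
    by rewrite mulNr divfK ?gt_eqF.
  by apply: gt0_ltr_powR; rewrite // nnegrE ?mulr_ge0 ?powR_ge0// ltW.
have -> : r `^ beta = r `^ g * r `^ be.
  by rewrite -powRD ?subrK// (gt_eqF r0) implybT.
by rewrite mulrA ltr_pM2r// powR_gt0.
Qed.

Lemma sum_rate_lt (R : realType) (p : nat) (alphas betas : 'I_p.+1 -> R)
    (beta D r x : R) :
  1 <= x -> 0 < D -> (forall i, betas i < beta) ->
  (\sum_i D `^ (beta - betas i)^-1) *
    x `^ (- min_family (fun i => alphas i / (beta - betas i))) < r ->
  D * \sum_i (x `^ (- alphas i) * r `^ betas i) < p.+1%:R * r `^ beta.
Proof.
move=> x1 D0 bb rlt.
rewrite mulr_sumr mulr_natl -[p.+1 in X in _ < X]card_ord -sumr_const.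
(* Termwise strict inequalities give a strict sum because the index set contains [ord0]. *)
apply: ltr_sum => [|i _]; first by apply/hasP; exists ord0; rewrite ?mem_index_enum.
apply: powR_rate_lt => //; first exact: lt_le_trans x1.
(* Each single constant is at most the sum of all of them, and since [1 <= x], the smallest rate
   exponent gives the largest power of [x]. *)
apply: le_lt_trans rlt; apply: ler_pM; rewrite ?powR_ge0//.
  by rewrite (bigD1 i)//= lerDl sumr_ge0// => j _; exact: powR_ge0.
apply: ler_powR => //; rewrite lerN2.
exact: (min_family_le (fun i => alphas i / (beta - betas i))).
Qed.

Theorem theorem2 (R : realType) (d : measure_display) (T : measurableType d)
    (P : probability T R) (A : Type) (k : nat)
    (G M N : nat -> T -> A -> 'rV[R]_k -> R)
    (a : nat -> T -> A) (b : nat -> T -> 'rV[R]_k)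
    (p : nat) (beta : R) (alphas betas : 'I_p.+1 -> R)
    (hG : forall n w, G n w (a n w) (b n w) <= G n w (a n w) 0)
    (hb : op1_star P (fun n w => enorm (b n w)))
    (hbeta : 0 < beta)
    (halphas : forall i, 0 <= alphas i)
    (hbetas : forall i, 0 <= betas i)
    (hbetas_lt : forall i, betas i < beta)
    (hGMN : forall n w (x : A) (y : 'rV[R]_k),
      G n w x y - G n w x 0 = M n w x y - N n w x y)
    (hM : exists c0 : R, 0 < c0 /\
      inner_prob P [set w |
        c0 * (enorm (b n w)) `^ beta <= M n w (a n w) (b n w)]
        @[n --> \oo] --> 1%E)
    (hN : Op_star P
      (fun n w => Num.max (N n w (a n w) (b n w)) 0)
      (fun n w => \sum_(i < p.+1)
        n%:R `^ (- alphas i) * (enorm (b n w)) `^ (betas i))) :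
  Op_star P
    (fun n w => enorm (b n w))
    (fun n _ => n%:R `^ (- min_family (fun i => alphas i / (beta - betas i))))
  /\
  ((forall n w (x : A) (y : 'rV[R]_k), Num.max (N n w x y) 0 = 0) ->
    inner_prob P [set w | b n w = 0] @[n --> \oo] --> 1%E).
Proof.
case: hM => c0 [c00 hM].
have MN n w : M n w (a n w) (b n w) <= Num.max (N n w (a n w) (b n w)) 0.
  by rewrite le_max -subr_le0 -hGMN subr_le0 hG.
split; last first.
  move=> N0.
  apply: (squeeze_cvge _ hM (cvg_cst 1%E)).
  apply: nearW => n; rewrite inner_prob_le1 andbT; apply: le_inner_prob.
  move=> w /= /le_trans /(_ (MN n w)); rewrite N0 pmulr_rle0// => r0.
  apply/enorm_eq0/eqP.
  have : enorm (b n w) `^ beta == 0 by rewrite eq_le r0 powR_ge0.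
  by rewrite powR_eq0 => /andP[].
move=> eps eps0; have [L hL] := hN _ eps0.
(* [L] may be zero or negative, whereas [D] must be positive. *)
pose L1 := Num.max L 1.
have L10 : 0 < L1 by rewrite lt_max ltr01 orbT.
pose D := L1 * p.+1%:R / c0.
have D0 : 0 < D by rewrite !mulr_gt0 ?invr_gt0.
exists (\sum_i D `^ (beta - betas i)^-1).
(* The slack [e] is shared equally between the failure of the bound on [N] and that of the bound on
   [M]. *)
apply/lee_addgt0Pr => e e0; rewrite -EFinD.
have e20 : 0 < e / 2 by rewrite divr_gt0.
apply: near_le_limn_esup.
near=> n.
have n1 : 1 <= n%:R :> R by rewrite ler1n; near: n; exists 1%N.
apply: (@le_trans _ _ (outer_prob P ([set w |
    (L * \sum_(i < p.+1) n%:R `^ (- alphas i) * (enorm (b n w)) `^ (betas i)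
      < `|Num.max (N n w (a n w) (b n w)) 0|)%R] `|`
    ~` [set w | c0 * (enorm (b n w)) `^ beta <= M n w (a n w) (b n w)]))).
  apply: le_outer_prob => w /=; rewrite ger0_norm ?enorm_ge0// => rlt.
  have [cM|] := pselect (c0 * enorm (b n w) `^ beta <= M n w (a n w) (b n w));
    last by right.
  left; rewrite ger0_norm ?le_max ?lexx ?orbT//.
  apply: lt_le_trans (le_trans cM (MN n w)).
  have := sum_rate_lt n1 D0 hbetas_lt rlt.
  set S := \sum_i (_ * _) => DS.
  have S0 : 0 <= S by apply: sumr_ge0 => i _; rewrite mulr_ge0 ?powR_ge0.
  apply: (@le_lt_trans _ _ (L1 * S)).
    by rewrite ler_wpM2r// le_max lexx.
  (* As [c0 * D = L1 * p.+1%:R], multiplying by [c0] leaves a factor [p.+1%:R] on both sides, which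
     cancels. *)
  move: DS; rewrite -(ltr_pM2l c00 (D * S)) mulrA (mulrC c0 D) divfK ?gt_eqF//.
  by rewrite [X in _ < X]mulrCA (mulrC L1) -mulrA ltr_pM2l.
apply: le_trans (outer_probU2 _ _ _) _.
rewrite [e]splitr addrA EFinD; apply: leeD.
  near: n; exact: (limn_esup_le_near hL e20).
apply/ltW/outer_prob_setC_lt.
(* The open ray above [1 - e / 2] is a neighbourhood of the limit 1. *)
near: n; apply: (hM [set y | (1 - (e / 2)%:E < y)%E]).
apply: open_nbhs_nbhs; split; first exact: open_ereal_gt_ereal.
by rewrite /= -EFinB lte_fin ltrBlDr ltrDl.
Unshelve. all: by end_near. Qed.
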